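(* Let $A=\{x_1,x_2\}$ be an alphabet of two variables. For every positive integer $n$, $$\sum_{k=0}^{n}\binom{n}{k}S_{n-k-1}(x_1+x_2)\,S_{k-1}(x_1+x_2)=\frac{1}{(x_1-x_2)^2}\left(2^n\phi_n(x_1+x_2)-2(x_1+x_2)^n\right),$$ $$\sum_{k=0}^{n}\binom{n}{k}\phi_{n-k}(x_1+x_2)\,\phi_k(x_1+x_2)=2^n\phi_n(x_1+x_2)+2(x_1+x_2)^n,$$ $$\sum_{k=0}^{n}\binom{n}{k}S_{n-k-1}(x_1+x_2)\,\phi_k(x_1+x_2)=2^nS_{n-1}(x_1+x_2).$$
   Context: Here $x_1,x_2$ are two commuting variables (indeterminates) and identities are in the field of rational functions in them. The notation $S_n(x_1+x_2)$, $\phi_n(x_1+x_2)$ denotes functions of the alphabet $\{x_1,x_2\}$ (not functions of the sum): $S_n(x_1+x_2)=\dfrac{x_1^{n+1}-x_2^{n+1}}{x_1-x_2}$ for $n\ge 0$, with $S_n(x_1+x_2)=0$ for $n<0$, and $\phi_n(x_1+x_2)=x_1^n+x_2^n$ for $n\ge 0$. The expression $(x_1+x_2)^n$ is the ordinary power of the sum. *)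

(* Defs.v *)
From mathcomp Require Import all_boot all_order all_algebra.
From mathcomp.multinomials Require Import mpoly.

Set Implicit Arguments.
Unset Strict Implicit.
Unset Printing Implicit Defensive.

Import GRing.Theory.
Local Open Scope ring_scope.

(* The field F(x_1, x_2) of rational functions; x_1, x_2 are [ratvar F 0] and
   [ratvar F 1]. *)
Notation ratfun2 F := {fraction {mpoly F[2]}}.

Definition ratvar (F : fieldType) (i : 'I_2) : ratfun2 F :=
  tofrac ('X_i : {mpoly F[2]}).

(* S_n and phi_n are functions of the alphabet {a, b}, not of the sum a + b.
   The index of S is an integer, so that S_{-1} = 0 is really the convention
   "S_n = 0 for n < 0" and not an artefact of truncated subtraction; the
   quotient is only meaningful for a != b. *)
Definition Ssym (K : fieldType) (n : int) (a b : K) : K :=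
  match n with
  | Posz m => (a ^+ m.+1 - b ^+ m.+1) / (a - b)
  | Negz _ => 0
  end.

Definition phisym (K : fieldType) (n : nat) (a b : K) : K := a ^+ n + b ^+ n.

(* Main.v *)
(* Both S_(m-1) and phi_m are combinations p * x_1^m + q * x_2^m, so the three
   identities are instances of a single bilinear extension of the binomial
   theorem: the diagonal terms give (x_i + x_i)^n = 2^n x_i^n and the cross
   terms give (x_1 + x_2)^n. *)
Require Import Defs.
From mathcomp Require Import all_boot all_order all_algebra.
From mathcomp.multinomials Require Import mpoly.
From mathcomp Require Import ring.

Import GRing.Theory.
Local Open Scope ring_scope.

(** At [m = 0] the index is -1: the convention gives 0, and on the right the two terms cancel since
    both powers are 1. *)
Lemma Ssym_predE (K : fieldType) (m : nat) (a b : K) :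
  Ssym (m%:Z - 1) a b = (a - b)^-1 * a ^+ m - (a - b)^-1 * b ^+ m.
Proof.
case: m => [|m]; first by rewrite !expr0 subrr.
by rewrite -addn1 PoszD addrK /= addn1 mulrC mulrBr.
Qed.

Lemma sum_bin_combination (R : comNzRingType) (n : nat) (a b p q r s : R) :
  \sum_(k < n.+1) 'C(n, k)%:R * (p * a ^+ (n - k) + q * b ^+ (n - k))
      * (r * a ^+ k + s * b ^+ k)
  = 2 ^+ n * (p * r * a ^+ n + q * s * b ^+ n) + (p * s + q * r) * (a + b) ^+ n.
Proof.
(* [b + a] keeps this order so that [exprDn] yields [b ^+ (n - k) * a ^+ k], the [q * r] term of the
   expanded product. *)
have -> : 2 ^+ n * (p * r * a ^+ n + q * s * b ^+ n)
            + (p * s + q * r) * (a + b) ^+ n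
          = p * r * (a + a) ^+ n + p * s * (a + b) ^+ n
            + q * r * (b + a) ^+ n + q * s * (b + b) ^+ n.
  have dbl (x : R) : (x + x) ^+ n = 2 ^+ n * x ^+ n.
    by rewrite -mulr2n -(mulr_natl x) exprMn.
  by rewrite (dbl a) (dbl b) (addrC b a); ring.
rewrite !exprDn !mulr_sumr -!big_split /=.
by apply: eq_bigr => k _; ring.
Qed.

(** The inverse of [x1 - x2] enters only as a scalar [d] that is never cancelled, so the identities
    hold for any two elements of any field. *)
Lemma binomial_identities_field (K : fieldType) (n : nat) (x1 x2 : K) :
  [/\ \sum_(k < n.+1) 'C(n, k)%:R
          * Ssym (n%:Z - k%:Z - 1) x1 x2 * Ssym (k%:Z - 1) x1 x2
        = 1 / (x1 - x2) ^+ 2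
          * (2 ^+ n * phisym n x1 x2 - 2 * (x1 + x2) ^+ n),
      \sum_(k < n.+1) 'C(n, k)%:R * phisym (n - k) x1 x2 * phisym k x1 x2
        = 2 ^+ n * phisym n x1 x2 + 2 * (x1 + x2) ^+ n
    & \sum_(k < n.+1) 'C(n, k)%:R
          * Ssym (n%:Z - k%:Z - 1) x1 x2 * phisym k x1 x2
        = 2 ^+ n * Ssym (n%:Z - 1) x1 x2].
Proof.
set d := (x1 - x2)^-1.
have SE (m : nat) : Ssym (m%:Z - 1) x1 x2 = d * x1 ^+ m + - d * x2 ^+ m.
  by rewrite Ssym_predE mulNr.
(* Since [k <= n], the integer difference is the natural number [n - k]. *)
have SBE (k : 'I_n.+1) : Ssym (n%:Z - k%:Z - 1) x1 x2
    = d * x1 ^+ (n - k) + - d * x2 ^+ (n - k).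
  by rewrite subzn ?SE // -ltnS.
have phiE m : phisym m x1 x2 = 1 * x1 ^+ m + 1 * x2 ^+ m by rewrite !mul1r.
split.
(* Here [p = r = d] and [q = s = - d]: diagonal coefficients [d ^+ 2], cross coefficient
   [- 2 * d ^+ 2]. *)
- under eq_bigr do rewrite SBE SE.
  by rewrite sum_bin_combination phiE mul1r -exprVn -/d; ring.
- under eq_bigr do rewrite !phiE.
  by rewrite sum_bin_combination phiE; ring.
(* Here [p = d], [q = - d], [r = s = 1]: the cross coefficient [d - d] vanishes, so no power of
   [x1 + x2] survives. *)
- under eq_bigr do rewrite SBE phiE.
  by rewrite sum_bin_combination SE; ring.
Qed.

Theorem theorem1 (F : fieldType) (n : nat) (hn : (0 < n)%N) :
  let x1 : ratfun2 F := ratvar F 0 in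
  let x2 : ratfun2 F := ratvar F 1 in
  [/\ \sum_(k < n.+1) 'C(n, k)%:R
          * Ssym (n%:Z - k%:Z - 1) x1 x2 * Ssym (k%:Z - 1) x1 x2
        = 1 / (x1 - x2) ^+ 2
          * (2 ^+ n * phisym n x1 x2 - 2 * (x1 + x2) ^+ n),
      \sum_(k < n.+1) 'C(n, k)%:R * phisym (n - k) x1 x2 * phisym k x1 x2
        = 2 ^+ n * phisym n x1 x2 + 2 * (x1 + x2) ^+ n
    & \sum_(k < n.+1) 'C(n, k)%:R
          * Ssym (n%:Z - k%:Z - 1) x1 x2 * phisym k x1 x2
        = 2 ^+ n * Ssym (n%:Z - 1) x1 x2].
Proof. exact: binomial_identities_field. Qed.
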